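(* Let $\mathcal{N}$ be a network with capacity $\gamma$, and consider the dynamic congestion game $\Gamma(\mathcal{N},\delta)$ with uniform inflow $\delta\le\gamma$. Let $f^{*}$ be an optimal feasible min-cost (static) network flow with value $\delta$ and let $F^{*}$ be a corresponding flow over routes. Then there exists a socially optimal strategy profile $\sigma\in\mathcal{O}(\mathcal{N},\delta)$ such that for each stage $t\in\mathbb{N}_{+}$ and each route $r\in\mathcal{R}$, $$N^{r}_{t}(\sigma)=F^{*}_{r}.$$
   Context: **Network.** $\mathbb{N}=\{0,1,2,\dots\}$, $\mathbb{N}_{+}=\{1,2,\dots\}$. A network $\mathcal{N}=(\mathcal{G},(\tau_e)_{e\in E},(\gamma_e)_{e\in E})$ consists of a finite directed multigraph $\mathcal{G}=(V,E)$ and, for each edge $e$, a free-flow transit cost $\tau_e\in\mathbb{N}$ and a positive integer capacity $\gamma_e$. A path is a finite sequence of edges $(e_1,\dots,e_n)$ with the head of $e_i$ equal to the tail of $e_{i+1}$. There is a unique source $s$ (only outgoing edges) and a unique destination $d$ (only incoming edges), and for each vertex $v\ne s,d$ there is a path from $s$ to $v$ and a path from $v$ to $d$. A route is a path from $s$ to $d$; $\mathcal{R}$ is the set of routes. **Capacity of the network.** A cut is a set $C\subseteq E$ such that each route contains at least one edge of $C$; its capacity is $\gamma_C=\sum_{e\in C}\gamma_e$. A minimum cut is a cut of minimum capacity, and the capacity $\gamma$ of $\mathcal{N}$ is the capacity of any minimum cut. **Game $\Gamma(\mathcal{N},\delta)$.** Time is discrete. At each stage $t\in\mathbb{N}_{+}$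 a generation $G_t$ of $\delta$ players departs from $s$; $[it]$ denotes the $i$-th player of $G_t$, and $G=\bigcup_t G_t$. Priority: $[js]\lhd[it]$ iff $s<t$, or $s=t$ and $j<i$. Each player chooses a route; a strategy profile is $\sigma\in\mathcal{R}^{G}$. Player $[it]$ enters the first edge of her route at time $t$. A player entering edge $e$ at time $u$ reaches its head at time $u+\tau_e$, where there may be a queue. Players in the queue of $e$ are ordered by time of entry into $e$, ties being broken by the priority $\lhd$ (no overtaking). At each stage at most $\gamma_e$ players, the first ones in the queue, exit $e$: a player who has reached the head exits at that stage if fewer than $\gamma_e$ players are in the queue ahead of her, and otherwise waits one stage and the process repeats. A player exiting $e$ at some stage enters the next edge of her route at the same stage, or leaves the system if she is at $d$. **Latencies.** The latency of $[it]$ is $\ell_{it}(\sigma)=c_{it}(\sigma)+w_{it}(\sigma)$, where $c_{it}(\sigma)$ is the sum of $\tau_e$ over the edges of her route and $w_{it}(\sigma)$ is the total number of stages she spends waiting in queues. Put $\ell_t(\sigma)=\sum_{[it]\in G_t}\ell_{it}(\sigma)$ and $\bar L_T(\sigma)=\frac1T\sum_{t=1}^{T}\ell_t(\sigma)$. **Optimality.** $\sigma$ is socially optimal if $\liminf_{T\to\infty}\bar L_T(\sigma')\ge\limsup_{T\to\infty}\bar L_T(\sigma)$ for all $\sigma'\in\mathcal{R}^G$; $\mathcal{O}(\mathcal{N},\delta)$ is the set of such profiles. $N^{r}_{t}(\sigma)$ is the number of players of generation $G_t$ who choose route $r$ under $\sigma$. **Static flows.** A static network flow assigns a nonnegative integer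 $f_e$ to each $e\in E$; it is feasible if $f_e\le\gamma_e$ for all $e$ and inflow equals outflow at each vertex $v\neq s,d$; its value is the inflow at $d$. An optimal feasible min-cost flow of value $\delta$ minimizes $\sum_e\tau_e f_e$ among feasible flows with value $\delta$. A flow over routes $F$ assigns a nonnegative integer $F_r$ to each route $r$ with $\sum_{r\in\mathcal{R}}F_r=\delta$; it induces the edge flow $f_e=\sum_{r: e\in r}F_r$. A flow over routes $F^*$ corresponds to $f^*$ if it induces $f^*$.
   Formalization: In the edge flow induced by a flow over routes, an edge is counted as many times as the route traverses it, rather than once when e∈r; with plain membership the claim fails for routes that repeat an edge of a zero-cost cycle. *)

(* Defs.v *)
From HB Require Import structures.
From mathcomp Require Import all_boot all_order all_algebra finmap.
From mathcomp Require Import all_classical all_reals ereal sequences.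
From mathcomp Require Import zify.

Set Implicit Arguments.
Unset Strict Implicit.
Unset Printing Implicit Defensive.

Import Order.TTheory GRing.Theory Num.Theory.

(* A path is a nonempty sequence of edges; vertices and edges may repeat. *)
Definition is_walk (V : eqType) (E : Type) (tail head : E -> V)
    (u v : V) (p : seq E) : bool :=
  if p is e :: p' then
    [&& tail e == u, path (fun e1 e2 => head e1 == tail e2) e p'
      & head (last e p') == v]
  else false.

Record network := Network {
  vertex : finType;
  edge : finType;
  tail : edge -> vertex;
  head : edge -> vertex;
  transit : edge -> nat;
  cap : edge -> nat;
  source : vertex;
  dest : vertex;
  cap_gt0 : forall e, 0 < cap e;
  source_neq_dest : source != dest;
  sourceP : forall v, (forall e, head e != v) <-> v = source;
  destP : forall v, (forall e, tail e != v) <-> v = dest;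
  from_source : forall v, v != source -> v != dest ->
    exists p, is_walk tail head source v p;
  to_dest : forall v, v != source -> v != dest ->
    exists p, is_walk tail head v dest p }.

Arguments tail {n}.
Arguments head {n}.
Arguments transit {n}.
Arguments cap {n}.

Definition route (N : network) : choiceType :=
  {p : seq (edge N) | is_walk tail head (source N) (dest N) p}.

Definition edges (N : network) (r : route N) : seq (edge N) := val r.

Definition is_cut (N : network) (C : {set edge N}) : Prop :=
  forall r : route N, has (mem C) (edges r).

Definition cut_cap (N : network) (C : {set edge N}) : nat :=
  \sum_(e in C) cap e.

Definition is_min_cut (N : network) (C : {set edge N}) : Prop :=
  is_cut C /\ forall C' : {set edge N}, is_cut C' -> cut_cap C <= cut_cap C'.

(* The default [set: edge N] is a cut, so this is the minimum over all cuts: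
   see network_capP. *)
Definition network_cap (N : network) : nat :=
  cut_cap [arg min_(C < [set: edge N] | `[< is_cut C >]) cut_cap C].

Lemma network_capP (N : network) :
  exists2 C : {set edge N}, is_min_cut C & network_cap N = cut_cap C.
Proof.
have cutT : `[< is_cut [set: edge N] >].
  apply/asboolP => -[[|e p] //= wp].
  by rewrite /edges /= inE.
rewrite /network_cap; case: arg_minnP => // C /asboolP cC minC.
by exists C => //; split=> // C' /asboolP; apply: minC.
Qed.

(* Generations are counted from 0: the pair (t, i) stands for the player
   [(i+1)(t+1)], who departs at stage t + 1. *)
Definition player (delta : nat) : Type := (nat * 'I_delta)%type.

Definition departure (delta : nat) (p : player delta) : nat := p.1.+1.

Definition profile (N : network) (delta : nat) := player delta -> route N.

Definition priority (delta : nat) : rel (player delta) :=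
  fun q p => (q.1 < p.1) || (q.1 == p.1) && (q.2 < p.2).

(* A visit (p, k) is the passage of player p through the edge number k (from
   0) of her route. Visits with the same entry time are ordered by priority;
   the last clause only matters for a player who enters the same edge twice at
   the same stage, around a cycle of zero transit cost. *)
Definition before (delta : nat) : rel (nat * player delta * nat) :=
  fun y x =>
    let: (b, q, j) := y in let: (a, p, k) := x in
    (b < a) || (b == a) && (priority q p || (q == p) && (j < k)).

(* In the following definitions x p k is the stage at which player p exits
   the edge number k of her route. *)
Definition entry (delta : nat) (x : player delta -> nat -> nat)
    (p : player delta) (k : nat) : nat :=
  if k is k'.+1 then x p k' else departure p.

Definition in_queue (N : network) (delta : nat) (sigma : profile N delta)
    (x : player delta -> nat -> nat) (e : edge N) (u : nat)
    (q : player delta) (j : nat) : bool :=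
  (onth (edges (sigma q)) j == Some e)
  && (entry x q j + transit e <= u <= x q j).

(* Number of visits in the queue of e at stage u that are ahead of (p, k).
   The players in the system at stage u have left at stages 1, ..., u. *)
Definition queue_ahead (N : network) (delta : nat) (sigma : profile N delta)
    (x : player delta -> nat -> nat) (e : edge N) (u : nat)
    (p : player delta) (k : nat) : nat :=
  \sum_(t < u) \sum_(i < delta)
    \sum_(j < size (edges (sigma (nat_of_ord t, i))))
      (in_queue sigma x e u (nat_of_ord t, i) j
       && before (entry x (nat_of_ord t, i) j, (nat_of_ord t, i), nat_of_ord j)
                 (entry x p k, p, k)).

(* Each player exits e at the first stage, from the one at which she reaches
   the head of e, when fewer than cap e players are ahead of her. *)
Definition is_outcome (N : network) (delta : nat) (sigma : profile N delta)
    (x : player delta -> nat -> nat) : Prop :=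
  forall p k e, onth (edges (sigma p)) k = Some e ->
    [/\ entry x p k + transit e <= x p k,
        queue_ahead sigma x e (x p k) p k < cap e
      & forall u, entry x p k + transit e <= u < x p k ->
          cap e <= queue_ahead sigma x e u p k].

Lemma before_wf (delta : nat) : well_founded (@before delta).
Proof.
move=> [[u [t i]] k].
elim/ltn_ind: u t i k => u IHu; elim/ltn_ind => t IHt i.
have [n ni] : exists n, nat_of_ord i = n by exists i.
elim/ltn_ind: n i ni => n IHn i ni; elim/ltn_ind => k IHk.
constructor => -[[b [s j]] l] /= /orP[/IHu //|/andP[/eqP -> {b}]].
rewrite /priority /= => /orP[/orP[/IHt //|/andP[/eqP -> {s} ji]]|/andP[/eqP[-> ->]]].
  by rewrite ni in ji; apply: (IHn _ ji j erefl).
exact: IHk.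
Qed.

Lemma before_trans (delta : nat) : transitive (@before delta).
Proof.
move=> [[b [s j]] l] [[a [t i]] k] [[c [r h]] m] /=; rewrite /priority /=.
rewrite !xpair_eqE -!val_eqE /=.
lia.
Qed.

Lemma wf_fixpoint (A : Type) (R : A -> A -> Prop)
    (Phi : (A -> bool) -> A -> bool) :
    well_founded R ->
    (forall f g a, (forall b, R b a -> f b = g b) -> Phi f a = Phi g a) ->
  exists f, forall a, f a = Phi f a.
Proof.
move=> wfR loc.
pose F a (rec : forall b, R b a -> bool) :=
  Phi (fun b => if pselect (R b a) is left h then rec b h else false) a.
exists (Fix wfR (fun _ => bool) F) => a.
rewrite Fix_eq => [|c f g fg]; last first.
  by apply: loc => b _; case: pselect.
by apply: loc => b Rba; case: pselect.
Qed.

Section Existence.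
Variables (N : network) (delta : nat) (sigma : profile N delta).
Local Notation event := (nat * player delta * nat)%type.
Implicit Types (X Y : event -> bool) (p q : player delta).

Let entered X v p k : bool :=
  if k is k'.+1 then X (v, p, k') else v == departure p.

Let pending X u q j : bool := [forall v : 'I_u, ~~ X (nat_of_ord v, q, j)].

Let ahead X (e : edge N) u a p k : nat :=
  \sum_(t < u) \sum_(i < delta)
    \sum_(j < size (edges (sigma (nat_of_ord t, i))))
      [&& onth (edges (sigma (nat_of_ord t, i))) j == Some e,
          pending X u (nat_of_ord t, i) j
        & [exists b : 'I_u.+1,
            [&& before (nat_of_ord b, (nat_of_ord t, i), nat_of_ord j) (a, p, k),
                b + transit e <= u
              & entered X b (nat_of_ord t, i) j]]].

Let step X (ev : event) : bool :=
  let: (u, p, k) := ev in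
  pending X u p k &&
  [exists a : 'I_u.+1, entered X a p k &&
    if onth (edges (sigma p)) k is Some e then
      (a + transit e <= u) && (ahead X e u a p k < cap e)
    else false].

Let step_local X Y ev : (forall ev', before ev' ev -> X ev' = Y ev') ->
  step X ev = step Y ev.
Proof.
case: ev => [[u p] k] XY.
have pXY q j : pending X u q j = pending Y u q j.
  by apply: eq_forallb => v; rewrite XY //= ltn_ord.
have eXY (a : nat) q j : a <= u -> (a = u -> before (u, q, j) (u, p, k.+1)) ->
    entered X a q j = entered Y a q j.
  case: j => //= j au auE; apply: XY => /=.
  move: au; rewrite leq_eqVlt => /orP[/eqP au|-> //].
  have := auE au; rewrite au eqxx ltnn /=.
  by case/orP=> [->//|/andP[-> jk]]; rewrite ltnS in jk; rewrite jk orbT.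
rewrite /step pXY; congr (_ && _); apply: eq_existsb => a.
rewrite eXY ?leq_ord //; last by move=> _ /=; rewrite !eqxx ltnSn !orbT.
congr (_ && _); case: onth => // e; congr (_ && (_ < _)).
rewrite /ahead; apply: eq_bigr => t _; apply: eq_bigr => i _.
apply: eq_bigr => j _; rewrite pXY; congr (nat_of_bool [&& _, _ & _]).
apply: eq_existsb => b.
case bef: before => //=; congr (_ && _); apply: eXY; first exact: leq_ord.
move=> bu; move: bef; rewrite /= bu eqxx ltnn /=.
case/orP; first by rewrite ltnNge leq_ord.
by case/andP=> _ /orP[->//|/andP[-> jk]]; rewrite ltnS (ltnW jk) orbT.
Qed.

Lemma outcome_exists : exists x, is_outcome sigma x.
Proof.
have [X XE] := wf_fixpoint (@before_wf delta) step_local.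
have Xuniq u v p k : X (u, p, k) -> X (v, p, k) -> u = v.
  wlog uv : u v / u < v => [wl Xu Xv|].
    by case: (ltngtP u v) => // uv; [apply: wl|apply/esym/wl].
  by move=> Xu; rewrite XE /= => /andP[/forallP /(_ (Ordinal uv))]; rewrite Xu.
have Euniq u v p k : entered X u p k -> entered X v p k -> u = v.
  by case: k => [/= /eqP -> /eqP ->|k] //; apply: Xuniq.
have Xent u p k : X (u, p, k) -> exists e a,
    [/\ onth (edges (sigma p)) k = Some e, entered X a p k,
        a + transit e <= u & ahead X e u a p k < cap e].
  rewrite XE /= => /andP[_ /existsP[a /andP[ea]]].
  by case: onth => // e /andP[ae h]; exists e, a.
(* a visit that has started ends *)
have Xex a p k e : onth (edges (sigma p)) k = Some e -> entered X a p k ->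
    exists u, X (u, p, k).
  have [ev evE] : exists ev, ev = (a, p, k) by exists (a, p, k).
  elim: (before_wf ev) a p k e evE => {}ev _ IH a p k e evE ke ea.
  apply: contrapT => noX.
  have Xf u : X (u, p, k) = false by apply/negP => h; apply: noX; exists u.
  have [M MP] : exists M, forall (t : 'I_a) i
      (j : 'I_(size (edges (sigma (nat_of_ord t, i))))) b u,
      entered X b (nat_of_ord t, i) j ->
      before (b, (nat_of_ord t, i), nat_of_ord j) (a, p, k) ->
      X (u, (nat_of_ord t, i), nat_of_ord j) -> u < M.
    pose m (t : 'I_a) i (j : 'I_(size (edges (sigma (nat_of_ord t, i))))) : nat :=
      xget 0 [set u | X (u, (nat_of_ord t, i), nat_of_ord j)]%classic.
    exists (\sum_t \sum_i \sum_j m t i j).+1 => t i j b u _ _ Xu.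
    have -> : u = m t i j.
      by rewrite /m; case: xgetP => [v _|/(_ u)//]; apply: Xuniq.
    rewrite ltnS (bigD1 t) //= (bigD1 i) //= (bigD1 j) //= -!addnA.
    exact: leq_addr.
  pose u := a + transit e + M.
  suff : X (u, p, k) by rewrite Xf.
  rewrite XE /=; apply/andP; split.
    by apply/forallP => v; rewrite Xf.
  have au : a < u.+1 by rewrite ltnS /u -addnA leq_addr.
  apply/existsP; exists (Ordinal au); rewrite /= ea ke /= leq_addr /=.
  rewrite [X in X < _](_ : _ = 0) ?cap_gt0 //.
  apply: big1 => t _; apply: big1 => i _; apply: big1 => j _.
  apply/eqP; rewrite eqb0; apply/negP => /and3P[/eqP je pend /existsP[b]].
  move=> /and3P[bef bu eb].
  have [v Xv] : exists v, X (v, (nat_of_ord t, i), nat_of_ord j).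
    by apply: (IH (nat_of_ord b, (nat_of_ord t, i), nat_of_ord j)) je eb => //; rewrite evE.
  have dep : forall j b q, entered X b q j -> departure q <= b.
    elim => [|l IHl] c q; first by move=> /= /eqP ->.
    move=> /= /Xent[e' [c' [_ /IHl h h' _]]].
    by apply: leq_trans h _; apply: leq_trans h'; apply: leq_addr.
  have ta : t < a.
    have := dep _ _ _ eb; rewrite /departure /= => /leq_trans; apply.
    by move: bef => /= /orP[/ltnW//|/andP[/eqP->]].
  have vM : v < M by apply: (MP (Ordinal ta) i j b).
  have vu : v < u by apply: leq_trans vM _; apply: leq_addl.
  by move/forallP: pend => /(_ (Ordinal vu)); rewrite Xv.
pose x p k : nat := xget 0 [set u | X (u, p, k)]%classic.
have xP u p k : X (u, p, k) -> x p k = u.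
  by move=> Xu; rewrite /x; case: xgetP => [v _|/(_ u)//]; move/Xuniq; apply.
have fin p k : k < size (edges (sigma p)) ->
    X (x p k, p, k) /\ entered X (entry x p k) p k.
  elim: k => [|k IHk] kp.
    have e0 : entered X (departure p) p 0 by rewrite /= eqxx.
    move: (kp); rewrite -onthTE; case ke: onth => [e|] // _.
    by have [u Xu] := Xex _ _ _ _ ke e0; rewrite (xP u) // Xu e0.
  have [Xk _] := IHk (ltnW kp).
  move: (kp); rewrite -onthTE; case ke: onth => [e|] // _.
  by have [u Xu] := Xex (x p k) p k.+1 _ ke Xk; rewrite (xP u) // Xu /=.
have ent b q j : j < size (edges (sigma q)) -> entered X b q j -> b = entry x q j.
  by move=> /fin[_ h] /Euniq; apply.
have aheadE e u p k :
    k < size (edges (sigma p)) -> entry x p k <= u ->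
    queue_ahead sigma x e u p k = ahead X e u (entry x p k) p k.
  move=> kp epk; apply: eq_bigr => t _; apply: eq_bigr => i _.
  apply: eq_bigr => j _; congr (nat_of_bool _); rewrite /in_queue -!andbA.
  case: eqP => //= je; have [Xj ej] := fin (nat_of_ord t, i) j (ltn_ord j).
  have -> : pending X u (nat_of_ord t, i) j = (u <= x (nat_of_ord t, i) j).
    apply/forallP/idP => [h|h v].
      by rewrite leqNgt; apply/negP => lt; move: (h (Ordinal lt)); rewrite Xj.
    by apply/negP => /xP vE; move: (ltn_ord v); rewrite -vE ltnNge h.
  rewrite andbCA; congr (_ && _); apply/andP/existsP => [[h1 h2]|[b]].
    have lt : entry x (nat_of_ord t, i) j < u.+1.
      by rewrite ltnS; apply: leq_trans h1; apply: leq_addr.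
    by exists (Ordinal lt); rewrite /= in h2 *; rewrite h2 h1 ej.
  by move=> /and3P[h1 h2 /ent <- //].
exists x => p k e ke.
have kp : k < size (edges (sigma p)) by rewrite -onthTE ke.
have [Xk ek] := fin _ _ kp.
have [e' [a [ke' ea h1 h2]]] := Xent _ _ _ Xk.
move: ke'; rewrite ke => -[ee]; subst e'.
have aE := ent _ _ _ kp ea; subst a.
split=> //.
  by rewrite aheadE //; apply: leq_trans h1; apply: leq_addr.
move=> u /andP[u1 u2].
have eu : entry x p k <= u by apply: leq_trans u1; apply: leq_addr.
rewrite leqNgt; apply/negP; rewrite aheadE // => lt.
suff /xP xu : X (u, p, k) by rewrite xu ltnn in u2.
rewrite XE /=; apply/andP; split.
  apply/forallP => v; apply/negP => /xP vE.
  by have := ltn_trans (ltn_ord v) u2; rewrite vE ltnn.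
have eu' : entry x p k < u.+1 by [].
by apply/existsP; exists (Ordinal eu'); rewrite ek ke u1 lt.
Qed.

Lemma outcome_unique x y : is_outcome sigma x -> is_outcome sigma y ->
  forall p k, k < size (edges (sigma p)) -> x p k = y p k.
Proof.
suff main ev : let: (u, p, k) := ev in forall x y,
    is_outcome sigma x -> is_outcome sigma y ->
    k < size (edges (sigma p)) -> x p k = u -> y p k = u.
  by move=> ox oy p k kp; have /= := main (x p k, p, k) x y ox oy kp erefl.
elim: (before_wf ev) => {}ev _; case: ev => [[u p] k] IH {}x {}y ox oy kp xu.
have IHxy v q j : before (v, q, j) (u, p, k) -> j < size (edges (sigma q)) ->
    (x q j == v) = (y q j == v).
  by move=> bef jq; apply/eqP/eqP; apply: (IH _ bef).
have IHlt v q j : v < u -> j < size (edges (sigma q)) ->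
    (x q j == v) = (y q j == v).
  by move=> vu; apply: IHxy; rewrite /= vu.
have IHle q j : j < size (edges (sigma q)) -> (u <= x q j) = (u <= y q j).
  move=> jq; rewrite leqNgt [RHS]leqNgt; congr (~~ _); apply/idP/idP => lt.
    have /eqP -> // : y q j == x q j by rewrite -(IHlt _ _ _ lt jq) eqxx.
  have /eqP -> // : x q j == y q j by rewrite (IHlt _ _ _ lt jq) eqxx.
have ent v q j : v <= u -> (v = u -> before (u, q, j) (u, p, k.+1)) ->
    j < size (edges (sigma q)) -> (entry x q j == v) = (entry y q j == v).
  case: j => //= j vu vuE jq; apply: IHxy; last exact: ltnW.
  move: vu; rewrite /= leq_eqVlt => /orP[/eqP vu|-> //].
  have := vuE vu; rewrite vu eqxx ltnn /=.
  by case/orP=> [->//|/andP[-> jk]]; rewrite ltnS in jk; rewrite jk orbT.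
move: (kp); rewrite -onthTE; case ke: onth => [e|] // _.
have [x1 x2 x3] := ox _ _ _ ke; have [y1 y2 y3] := oy _ _ _ ke.
have exu : entry x p k <= u by rewrite -xu; apply: leq_trans x1; apply: leq_addr.
have eE : entry y p k = entry x p k.
  apply/eqP; rewrite -ent ?eqxx // => _ /=.
  by rewrite !eqxx ltnSn !orbT.
have qE : queue_ahead sigma x e u p k = queue_ahead sigma y e u p k.
  apply: eq_bigr => t _; apply: eq_bigr => i _; apply: eq_bigr => j _.
  congr (nat_of_bool _); rewrite /in_queue eE -!andbA.
  set q := (nat_of_ord t, i); have jq : j < size (edges (sigma q)) by [].
  rewrite IHle //; congr (_ && _).
  have key b : before (b, q, nat_of_ord j) (entry x p k, p, k) ->
      (entry x q j == b) = (entry y q j == b).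
    move=> bef; apply: ent => // [|bu].
      by move: bef => /= /orP[/ltnW/leq_trans->//|/andP[/eqP->]].
    move: bef; rewrite /= bu eqxx ltnn /=.
    case/orP; first by rewrite ltnNge exu.
    by case/andP=> _ /orP[->//|/andP[-> jk]]; rewrite ltnS (ltnW jk) orbT.
  apply/and3P/and3P => -[h1 h2 h3].
    have /eqP -> // : entry y q j == entry x q j by rewrite -(key _ h3) eqxx.
  have /eqP -> // : entry x q j == entry y q j by rewrite (key _ h3) eqxx.
case: (ltngtP (y p k) u) => // lt.
  have /eqP xy : x p k == y p k by rewrite (IHlt _ _ _ lt kp) eqxx.
  by rewrite -xy xu ltnn in lt.
have : cap e <= queue_ahead sigma y e u p k by apply: y3; rewrite lt eE -xu x1.
by rewrite -qE leqNgt -xu x2.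
Qed.

End Existence.

Definition exit_time (N : network) (delta : nat) (sigma : profile N delta) :
  player delta -> nat -> nat := sval (cid (outcome_exists sigma)).

Lemma exit_timeP (N : network) (delta : nat) (sigma : profile N delta) :
  is_outcome sigma (exit_time sigma).
Proof. exact: svalP (cid (outcome_exists sigma)). Qed.

Definition route_cost (N : network) (r : route N) : nat :=
  \sum_(e <- edges r) transit e.

Definition waiting (N : network) (delta : nat) (sigma : profile N delta)
    (p : player delta) : nat :=
  let x := exit_time sigma in
  \sum_(k < size (edges (sigma p)))
    (x p k - (entry x p k + nth 0 (map transit (edges (sigma p))) k)).

Definition latency (N : network) (delta : nat) (sigma : profile N delta)
    (p : player delta) : nat :=
  route_cost (sigma p) + waiting sigma p.

Definition generation_latency (N : network) (delta : nat)
    (sigma : profile N delta) (t : nat) : nat :=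
  \sum_(i < delta) latency sigma (t, i).

Definition average_latency (R : realType) (N : network) (delta : nat)
    (sigma : profile N delta) (T : nat) : R :=
  ((\sum_(t < T) generation_latency sigma t)%:R / T%:R)%R.

Definition socially_optimal (R : realType) (N : network) (delta : nat)
    (sigma : profile N delta) : Prop :=
  forall sigma' : profile N delta,
    (limn_esup (fun T => (average_latency R sigma T)%:E)
     <= limn_einf (fun T => (average_latency R sigma' T)%:E))%E.

Definition route_count (N : network) (delta : nat) (sigma : profile N delta)
    (t : nat) (r : route N) : nat :=
  #|[set i : 'I_delta | sigma (t, i) == r]|.

Definition feasible (N : network) (f : edge N -> nat) : Prop :=
  (forall e, f e <= cap e) /\
  (forall v, v != source N -> v != dest N ->
     \sum_(e | head e == v) f e = \sum_(e | tail e == v) f e).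

Definition flow_value (N : network) (f : edge N -> nat) : nat :=
  \sum_(e | head e == dest N) f e.

Definition flow_cost (N : network) (f : edge N -> nat) : nat :=
  \sum_e transit e * f e.

Definition min_cost_flow (N : network) (delta : nat) (f : edge N -> nat) :
    Prop :=
  [/\ feasible f, flow_value f = delta
    & forall g : edge N -> nat, feasible g -> flow_value g = delta ->
        flow_cost f <= flow_cost g].

(* A network with cycles has infinitely many routes, and a flow of finite
   value over the routes is finitely supported. *)
Definition route_flow (N : network) : Type := {fsfun route N -> nat with 0}.

Definition route_flow_value (N : network) (F : route_flow N) : nat :=
  \sum_(r <- finsupp F) F r.

(* An edge counts as many times as the route traverses it, that is at most
   once unless the route has a repeated edge. *)
Definition induced_flow (N : network) (F : route_flow N) (e : edge N) : nat :=
  \sum_(r <- finsupp F) F r * count_mem e (edges r).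

Definition corresponds (N : network) (F : route_flow N) (f : edge N -> nat) :
    Prop :=
  induced_flow F =1 f.

(* Main.v *)
(* The profile repeating F at every generation creates no queue, because the
   visits reaching the head of an edge e at a given stage number at most
   f e <= cap e; its average latency is therefore the cost of f.

   For the lower bound, f being of minimum cost, its residual graph has no
   negative cycle, which yields vertex potentials and, from their reduced costs,
   edge prices y and a number P such that every route costs at least P minus its
   total price, and cost f = P * delta - sum_e y e * cap e. In any profile a
   player either has latency at least P or has left every edge within P stages of
   her departure. Since at most cap e visits leave e at each stage, the prices
   paid by the latter players of the first T generations amount to at most
   (T + P + 1) * sum_e y e * cap e. So the total latency of these generations is
   at least T * cost f up to a constant. *)
Require Import Defs.
From mathcomp Require Import all_boot all_order all_algebra finmap.
From mathcomp Require Import all_classical all_reals ereal normedtype sequences.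
From mathcomp Require Import zify ring lra.

Set Implicit Arguments.
Unset Strict Implicit.
Unset Printing Implicit Defensive.

Import Defs Order.TTheory GRing.Theory Num.Theory.
Import numFieldNormedType.Exports.

(** * Vertex potentials in a graph without negative cycles *)

Section Potential.
Variables (V A : finType) (src tgt : A -> V) (c : A -> int) (R : pred A).

(* Walks are listed from their last arc to their first. *)
Fixpoint rwalk (v : V) (p : seq A) : bool :=
  if p is a :: p' then [&& R a, tgt a == v & rwalk (src a) p'] else true.

Lemma rwalk_cat v p q :
  rwalk v (p ++ q) = rwalk v p && rwalk (last v (map src p)) q.
Proof. by elim: p v => //= a p IH v; rewrite IH !andbA. Qed.

(** The sum telescopes, so only the two ends of the walk contribute; on a closed walk it vanishes at
    every [w]. *)
Lemma rwalk_balance v p w : rwalk v p ->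
  (\sum_(a <- p) ((tgt a == w)%:Z - (src a == w)%:Z)
    = (v == w)%:Z - (last v (map src p) == w)%:Z)%R.
Proof.
elim: p v => [v _|a p IH v /= /and3P[_ /eqP <- /IH {}IH]].
  by rewrite big_nil /= subrr.
by rewrite big_cons IH; lia.
Qed.

Lemma rwalk_all v p : rwalk v p -> all R p.
Proof. by elim: p v => //= a p IH v /and3P[-> _ /IH]. Qed.

Hypothesis cycle_ge0 : forall v p, rwalk v p -> last v (map src p) = v ->
  uniq (map src p) -> (0 <= \sum_(a <- p) c a)%R.

(** Shortest-path potentials: [pot v] is the least cost of a simple walk ending at [v], from any
    start, shifted by [B]. The empty walk competes at every vertex. *)
Lemma potential_exists : exists pot : V -> int,
  forall a, R a -> (pot (tgt a) <= pot (src a) + c a)%R.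
Proof.
pose simple v p := rwalk v p && uniq (v :: map src p).
have [B cB] : exists B : nat, forall v p, simple v p ->
    (- B%:Z <= \sum_(a <- p) c a)%R.
  (* A simple walk uses each arc at most once, so this sum bounds its cost from below; the shift by
     [B] then lets the minimum be taken in [nat]. *)
  exists (\sum_a `|c a|)%N => v p /andP[_ /= /andP[_ /map_uniq up]].
  rewrite (big_morph Posz PoszD (erefl (Posz 0))) -sumrN (big_uniq _ up) /=.
  rewrite [X in (_ <= X)%R]big_mkcond.
  by apply: ler_sum => a _; case: ifP => _; lia.
have /choice[pot potP] v : exists n : nat,
    (exists2 p, simple v p & (n%:Z = B%:Z + \sum_(a <- p) c a)%R) /\
    (forall p, simple v p -> (n%:Z <= B%:Z + \sum_(a <- p) c a)%R).
  have ex : exists n : nat,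
      `[< (exists2 p, simple v p & (n%:Z = B%:Z + \sum_(a <- p) c a)%R) >].
    by exists B; apply/asboolP; exists [::]; rewrite ?big_nil ?addr0.
  case: (ex_minnP ex) => n /asboolP nP nmin; exists n; split=> // p sp.
  have := cB _ _ sp => h.
  have := nmin `|(Posz B + \sum_(a <- p) c a)%R|%N; rewrite -lez_nat.
  rewrite gez0_abs; last lia.
  apply; apply/asboolP; exists p => //; lia.
exists (fun v => Posz (pot v)) => a Ra.
have [[p /andP[wp up] ->] _] := potP (src a); have [_ minT] := potP (tgt a).
rewrite -addrA.
have [tp|tp] := boolP (tgt a \in src a :: map src p); last first.
  have := minT (a :: p); rewrite big_cons [(c a + _)%R]addrC; apply.
  by rewrite /simple map_cons cons_uniq tp /= Ra eqxx wp.
(* the part of [a :: p] after its first passage through [tgt a] is a cycle *)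
have [p1 [p2 [pE lastp1]]] : exists p1 p2,
    p = p1 ++ p2 /\ last (src a) (map src p1) = tgt a.
  move eE : (map src p) tp => s tp; case/splitPl: tp eE => s1 s2 ls1 eE.
  exists (take (size s1) p), (drop (size s1) p).
  by rewrite cat_take_drop map_take eE take_size_cat.
subst p; move: wp up; rewrite rwalk_cat lastp1 => /andP[w1 w2].
rewrite map_cat -cat_cons cat_uniq => /and3P[up1 dis up2].
have : (0 <= \sum_(b <- a :: p1) c b)%R.
  by apply: (cycle_ge0 (v := tgt a)) => //=; rewrite Ra eqxx.
rewrite big_cons.
(* Removing the cycle [a :: p1], of nonnegative cost, leaves [p2], a simple walk to [tgt a] that
   costs no more than [a :: p]. *)
have : (Posz (pot (tgt a)) <= B%:Z + \sum_(b <- p2) c b)%R.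
  apply: minT; rewrite /simple w2 /= up2 andbT.
  apply: contra dis => tp2; apply/hasP; exists (tgt a) => //=.
  by rewrite -lastp1 mem_last.
by rewrite big_cat /=; lra.
Qed.
End Potential.

(** * Residual graph and duality for minimum-cost flows *)

Lemma Posz_sum (I : Type) (r : seq I) (P : pred I) (g : I -> nat) :
  Posz (\sum_(i <- r | P i) g i)%N = (\sum_(i <- r | P i) Posz (g i))%R.
Proof. exact: (big_morph Posz PoszD (erefl (Posz 0))). Qed.

Section Dual.
Variable N : network.
Implicit Types (g h : edge N -> nat).

(** The arc [(e, true)] sends one more unit through [e]; [(e, false)] takes one back. *)
Definition arc_src (a : edge N * bool) := if a.2 then tail a.1 else head a.1.
Definition arc_tgt (a : edge N * bool) := if a.2 then head a.1 else tail a.1.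
Definition arc_cost (a : edge N * bool) : int :=
  if a.2 then (transit a.1)%:Z%R else (- (transit a.1)%:Z)%R.
Definition residual g (a : edge N * bool) : bool :=
  if a.2 then g a.1 < cap a.1 else 0 < g a.1.

Lemma sum_arcs (p : seq (edge N * bool)) (w : edge N * bool -> int) : uniq p ->
  (\sum_(a <- p) w a = \sum_e ((((e, true) \in p)%:Z * w (e, true))
                             + ((e, false) \in p)%:Z * w (e, false)))%R.
Proof.
move=> up; rewrite (big_uniq _ up) /= big_mkcond /=.
transitivity (\sum_e \sum_b ((e, b) \in p)%:Z * w (e, b))%R; last first.
  by apply: eq_bigr => e _; rewrite big_bool.
rewrite pair_bigA /=; apply: eq_bigr => -[e b] _.
by case: ifP => _; rewrite ?mul1r ?mul0r.
Qed.

Lemma net_flowE g v :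
  (Posz (\sum_(e | head e == v) g e) - Posz (\sum_(e | tail e == v) g e)
   = \sum_e (g e)%:Z * ((head e == v)%:Z - (tail e == v)%:Z))%R.
Proof.
rewrite !Posz_sum [in X in (X - _)%R]big_mkcond [in X in (_ - X)%R]big_mkcond.
by rewrite -sumrB; apply: eq_bigr => e _; case: eqP; case: eqP => _ _ /=; lia.
Qed.

Lemma flow_valueE g :
  (Posz (flow_value g) =
     \sum_e (g e)%:Z * ((head e == dest N)%:Z - (tail e == dest N)%:Z))%R.
Proof.
rewrite -net_flowE [X in (_ - Posz X)%R]big_pred0 ?subr0 // => e.
exact: negbTE (proj2 (destP _) erefl e).
Qed.

(** Pushing one unit along the cycle turns [g] into a feasible flow of the same value, and the cost
    changes by exactly the cost of the cycle. *)
Lemma residual_cycle_ge0 delta g v p : min_cost_flow delta g ->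
  rwalk arc_src arc_tgt (residual g) v p -> last v (map arc_src p) = v ->
  uniq (map arc_src p) -> (0 <= \sum_(a <- p) arc_cost a)%R.
Proof.
move=> [[gcap gcons] gval gmin] wp cp usp; have up := map_uniq usp.
have /allP resp := rwalk_all wp.
have bal w := rwalk_balance w wp; rewrite cp in bal.
(* The truncated subtraction is exact: an arc [(e, false)] of the cycle is residual, so
   [0 < g e]. *)
pose h e := g e + ((e, true) \in p) - ((e, false) \in p).
have hE e : Posz (h e) = ((g e)%:Z + (((e, true) \in p)%:Z - ((e, false) \in p)%:Z))%R.
  rewrite /h; have := resp (e, false); case: (_ \in p) => /=; last lia.
  by move=> /(_ isT); rewrite /residual /=; lia.
have net w : (\sum_e (h e)%:Z * ((head e == w)%:Z - (tail e == w)%:Z)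
    = \sum_e (g e)%:Z * ((head e == w)%:Z - (tail e == w)%:Z))%R.
  apply/eqP; rewrite -subr_eq0 -sumrB; apply/eqP.
  rewrite -[RHS](subrr (v == w)%:Z%R) -bal (sum_arcs _ up).
  by apply: eq_bigr => e _; rewrite hE /arc_tgt /arc_src /=; ring.
have hfeas : feasible h.
  split=> [e|w ws wd].
    rewrite /h; have := resp (e, true); have := gcap e.
    case: (_ \in p) => /=; last lia.
    by move=> _ /(_ isT); rewrite /residual /=; lia.
  by apply/eqP; rewrite -eqz_nat -subr_eq0 net_flowE net -net_flowE gcons // subrr.
have hval : flow_value h = delta.
  by apply/eqP; rewrite -gval -eqz_nat !flow_valueE net.
have := gmin h hfeas hval; rewrite -lez_nat -subr_ge0 /flow_cost !Posz_sum -sumrB.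
rewrite (sum_arcs _ up); congr (_ <= _)%R; apply: eq_bigr => e _.
by rewrite !PoszM hE /arc_cost /=; ring.
Qed.

Lemma walk_telescope (pot : vertex N -> int) u v p : is_walk tail head u v p ->
  (\sum_(e <- p) (pot (head e) - pot (tail e)) = pot v - pot u)%R.
Proof.
case: p => //= e p /and3P[/eqP <- + /eqP <-].
elim: p e => [|e' p IH] e /=; first by rewrite big_seq1.
by move=> /andP[/eqP ee' /IH {}IH]; rewrite big_cons IH ee'; lia.
Qed.

Lemma sum_route_flow (F : route_flow N) (w : edge N -> int) :
  (\sum_(r <- finsupp F) (F r)%:Z * \sum_(e <- edges r) w e
    = \sum_e w e * (induced_flow F e)%:Z)%R.
Proof.
under [RHS]eq_bigr do rewrite Posz_sum big_distrr /=.
rewrite exchange_big /=; apply: eq_bigr => r _.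
under [RHS]eq_bigr do rewrite PoszM mulrCA.
rewrite -big_distrr /=; congr (_ * _)%R.
elim: (edges r) => [|e s IH]; first by rewrite big_nil big1 // => e _; rewrite mulr0.
rewrite big_cons IH /= (bigD1 e) //= [RHS](bigD1 e) //= eqxx PoszD mulrDr mulr1.
rewrite addrA; congr (_ + _)%R; apply: eq_bigr => e' ne.
by rewrite eq_sym (negbTE ne).
Qed.

(** [P] is the potential difference between destination and source, and [y e] the negative part of
    the reduced cost of [e]. The equality is complementary slackness. *)
Lemma dual_prices delta (f : edge N -> nat) (F : route_flow N) :
    min_cost_flow delta f -> route_flow_value F = delta -> corresponds F f ->
  exists (P : nat) (y : edge N -> nat),
    (forall r : route N, P <= route_cost r + \sum_(e <- edges r) y e) /\
    flow_cost f + \sum_e y e * cap e = P * delta.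
Proof.
move=> fmin Fval Ff.
have costE : (Posz (flow_cost f) =
    \sum_(r <- finsupp F) (F r)%:Z * (route_cost r)%:Z)%R.
  under eq_bigr do rewrite /route_cost Posz_sum.
  by rewrite sum_route_flow Posz_sum; apply: eq_bigr => e _; rewrite Ff PoszM.
(* If [delta = 0] then [f] costs nothing and zero prices do. If [delta > 0], the sign of [P] can be
   read off from [P * delta]. *)
have [d0|dpos] := posnP delta.
  exists 0, (fun=> 0); split=> //; rewrite [X in _ + X]big1 // mul0n addn0.
  apply/eqP; rewrite -eqz_nat costE big_seq big1 // => r rF.
  move: Fval; rewrite d0 /route_flow_value => /eqP; rewrite sum_nat_seq_eq0.
  by move=> /allP /(_ r rF) /= /eqP ->; rewrite mul0r.
have [pot potP] := potential_exists (fun v p => residual_cycle_ge0 (v := v) (p := p) fmin).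
pose red e : int := ((transit e)%:Z + pot (tail e) - pot (head e))%R.
pose y e := `|Num.min 0%R (red e)|%N.
have yE e : ((y e)%:Z = - Num.min 0%R (red e))%R.
  by rewrite /y; case: (lerP 0%R (red e)) => h; rewrite ?minEle; lia.
pose P := (pot (dest N) - pot (source N))%R.
have routeE (r : route N) : (Posz (route_cost r) = P + \sum_(e <- edges r) red e)%R.
  rewrite /P -(walk_telescope pot (valP r)) -big_split Posz_sum /=.
  by apply: eq_bigr => e _; rewrite /red; lia.
(* A forward residual arc forces [0 <= red e], a backward one [red e <= 0]. Hence [f e = cap e]
   where [red e < 0], and [f e = 0] where [red e > 0]. *)
have slack e : (red e * (f e)%:Z = - ((y e)%:Z * (cap e)%:Z))%R.
  have [[/(_ e) fcap _] _ _] := fmin.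
  have := potP (e, true); have := potP (e, false); have := cap_gt0 e.
  rewrite /residual /arc_src /arc_tgt /arc_cost /= yE.
  case: (lerP 0%R (red e)); rewrite /red; case: (posnP (f e)) => [->|fpos].
  - by rewrite mulr0 !(oppr0, mul0r).
  - by move=> h _ /(_ isT) h' _; rewrite (_ : (_ + _ - _)%R = 0%R) ?mul0r; lia.
  - by move=> h + _ => /[swap] /[apply]; lia.
  - have [lt|ge _ _ _ _] := ltnP (f e) (cap e); first by move=> h _ _ /(_ isT); lia.
    by have -> : f e = cap e; lia.
have costP : (Posz (flow_cost f) + Posz (\sum_e y e * cap e) = P * delta%:Z)%R.
  rewrite costE.
  rewrite (eq_bigr (fun r => (F r)%:Z * P + (F r)%:Z * \sum_(e <- edges r) red e)%R); last first.
    by move=> r _; rewrite routeE mulrDr.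
  rewrite big_split /= -big_distrl /= -Posz_sum -/(route_flow_value F) Fval.
  rewrite sum_route_flow Posz_sum mulrC -addrA -big_split /= big1 ?addr0 // => e _.
  by rewrite Ff slack PoszM addNr.
have Ppos : (0 <= P)%R.
  by rewrite -(pmulr_lge0 _ (_ : 0 < delta%:Z)%R) // -costP.
exists `|P|%N, y; split=> [r|].
  rewrite -lez_nat gez0_abs // PoszD routeE Posz_sum -addrA -big_split /= lerDl.
  by apply: sumr_ge0 => e _; rewrite yE; case: (lerP 0%R (red e)); lia.
by apply/eqP; rewrite -eqz_nat PoszD PoszM gez0_abs // costP.
Qed.
End Dual.

(** * Counting the visits that leave an edge *)

Lemma seq_max (T : eqType) (lt : rel T) (s : seq T) : transitive lt ->
    (forall x y, x != y -> lt x y || lt y x) -> s != [::] ->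
  exists2 m, m \in s & forall x, x \in s -> x != m -> lt x m.
Proof.
move=> tr tot; elim: s => // a [|b s] IH _.
  by exists a; rewrite ?mem_head // => x; rewrite inE => /eqP ->; rewrite eqxx.
have [//|m ms mmax] := IH.
have [am|am] := eqVneq a m.
  exists a; rewrite ?mem_head // => x; rewrite inE => /orP[->//|xs].
  by rewrite am; apply: mmax.
have /orP[lam|lma] := tot _ _ am.
  exists m; first by rewrite inE ms orbT.
  by move=> x; rewrite inE => /orP[/eqP -> //|]; apply: mmax.
exists a; rewrite ?mem_head // => x; rewrite inE => /orP[->//|xs _].
have [->//|xm] := eqVneq x m.
by apply: tr lma; apply: mmax.
Qed.

Lemma before_total delta (y x : nat * player delta * nat) :
  y != x -> before y x || before x y.
Proof.
move: y x => [[b [s j]] l] [[a [t i]] k] /=.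
by rewrite /priority /= !xpair_eqE -!val_eqE /=; lia.
Qed.

Lemma before_irr delta (x : nat * player delta * nat) : before x x = false.
Proof. by move: x => [[b [s j]] l] /=; rewrite /priority /= !ltnn !eqxx. Qed.

Section Dynamics.
Variables (N : network) (delta : nat) (sigma : profile N delta).
Variable x : player delta -> nat -> nat.
Local Notation visit := (player delta * nat)%type.
Implicit Types (p : player delta) (v : visit) (e : edge N).

(** Flattens the triple sum of [queue_ahead] into a duplicate-free list, so that sets of visits can
    be compared by inclusion. *)
Definition visits (T : nat) : seq visit :=
  [seq (p, k) | p <- [seq (t, i) | t <- iota 0 T, i <- enum 'I_delta],
                k <- iota 0 (size (edges (sigma p)))].

Definition visits_edge e v : bool := onth (edges (sigma v.1)) v.2 == Some e.

Lemma sum_visits T (h : visit -> nat) :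
  \sum_(v <- visits T) h v =
  \sum_(t < T) \sum_(i < delta) \sum_(k < size (edges (sigma (nat_of_ord t, i))))
     h ((nat_of_ord t, i), nat_of_ord k).
Proof.
rewrite !big_allpairs_dep -{1}[T]subn0 big_mkord.
apply: eq_bigr => t _; rewrite big_enum; apply: eq_bigr => i _.
by rewrite -[X in iota 0 X]subn0 big_mkord.
Qed.

Lemma mem_visits T v :
  (v \in visits T) = (v.1.1 < T) && (v.2 < size (edges (sigma v.1))).
Proof.
case: v => [[t i] k] /=; apply/allpairsPdep/andP => /=.
  move=> [_ [k' [/allpairsPdep[t' [i' [tT _ ->]]] kk [-> -> ->]]]].
  by move: tT kk; rewrite !mem_iota.
move=> [tT kk]; exists (t, i), k; rewrite mem_iota; split=> //.
by apply/allpairsPdep; exists t, i; rewrite mem_iota mem_enum.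
Qed.

Lemma visits_uniq T : uniq (visits T).
Proof.
apply: allpairs_uniq_dep => [||[p k] [q j] _ _ /= [-> ->] //].
  apply: allpairs_uniq_dep; rewrite ?iota_uniq ?enum_uniq //.
  by move=> [t i] [t' i'] _ _ /= [-> ->].
by move=> p _; apply: iota_uniq.
Qed.

Definition event_of v : nat * player delta * nat := (entry x v.1 v.2, v.1, v.2).

Lemma event_of_inj : injective event_of.
Proof. by move=> [p k] [q j] [_ -> ->]. Qed.

Lemma queue_aheadE e u p k : queue_ahead sigma x e u p k =
  count (fun v => in_queue sigma x e u v.1 v.2
                  && before (event_of v) (event_of (p, k))) (visits u).
Proof. by rewrite -sum1_count big_mkcond sum_visits. Qed.

Lemma visits_edge_size e v : visits_edge e v -> v.2 < size (edges (sigma v.1)).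
Proof. by move=> /eqP ke; rewrite -onthTE ke. Qed.

Hypothesis xP : is_outcome sigma x.

Lemma departure_le_exit p k : k < size (edges (sigma p)) -> p.1 < x p k.
Proof.
elim: k => [|k IH] kp; move: (kp); rewrite -onthTE; case ke: onth => [e|] // _.
  by have [h _ _] := xP ke; apply: leq_trans h; rewrite /= leq_addr.
have [h _ _] := xP ke; apply: leq_trans h; rewrite /=.
by apply: ltn_addr; apply: IH; apply: ltnW.
Qed.

(* All the visits leaving [e] at stage [u] are in the queue at [u], and all but
   the last one are ahead of the last one. *)
Lemma exits_le_cap e u T :
  count (fun v => visits_edge e v && (x v.1 v.2 == u)) (visits T) <= cap e.
Proof.
rewrite -size_filter; set s := seq.filter _ _.
have [->//|sn0] := eqVneq s [::].
have [m ms mmax] : exists2 m, m \in s &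
    forall v, v \in s -> v != m -> before (event_of v) (event_of m).
  apply: (seq_max (lt := fun v w => before (event_of v) (event_of w))) => //.
    by move=> w v z; apply: before_trans.
  by move=> v w vw; apply: before_total; rewrite (inj_eq event_of_inj).
have sP v : v \in s -> visits_edge e v /\ x v.1 v.2 = u.
  by rewrite mem_filter => /andP[/andP[? /eqP]].
have [/eqP me mu] := sP _ ms.
have [_ + _] := xP me; rewrite mu queue_aheadE -size_filter.
set w := seq.filter _ _; apply: leq_trans; rewrite -[_.+1]/(size (m :: w)).
apply: uniq_leq_size; first by rewrite filter_uniq ?visits_uniq.
move=> v vs; rewrite inE; have [->//|vm] := eqVneq v m.
have [ve vu] := sP _ vs; have vk := visits_edge_size ve.
have [xv _ _] := xP (eqP ve).
(* By [departure_le_exit], a visit that leaves at [u] has a generation index below [u], so it occurs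
   in [visits u]. *)
rewrite mem_filter -surjective_pairing mmax // mem_visits vk -{2}vu departure_le_exit //.
by rewrite /in_queue (eqP ve) eqxx -{1}vu xv vu leqnn.
Qed.

(** Sums [exits_le_cap] over the stages from 0 to [M], whence the factor [M.+1]. *)
Lemma early_exits_le e T M :
  count (fun v => visits_edge e v && (x v.1 v.2 <= M)) (visits T) <= cap e * M.+1.
Proof.
rewrite mulnC -[X in X * _]card_ord -sum_nat_const.
apply: leq_trans (leq_sum _ (fun (u : 'I_M.+1) _ => exits_le_cap e u T)).
rewrite -sum1_count big_mkcond; under [leqRHS]eq_bigr do rewrite -sum1_count big_mkcond.
rewrite exchange_big /=; apply: leq_sum => v _.
case: ifP => // /andP[ve vM]; rewrite (bigD1 (Ordinal (vM : _ < M.+1))) //=.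
by rewrite ve eqxx.
Qed.

(** Each summand is a transit cost plus a wait; the truncated subtraction is exact because no exit
    precedes the arrival at the head. *)
Lemma exit_timeE p k : k <= size (edges (sigma p)) ->
  let tau := nth 0 (map transit (edges (sigma p))) in
  entry x p k = departure p
    + \sum_(j < k) (tau j + (x p j - (entry x p j + tau j))).
Proof.
move=> + tau; elim: k => [|k IH] kp; first by rewrite big_ord0 addn0.
rewrite big_ord_recr /= addnA -IH; last exact: ltnW.
move: (kp); rewrite -onthTE; case ke: onth => [e|] // _.
have [+ _ _] := xP ke.
have -> : transit e = tau k.
  by rewrite /tau (nth_map e) // (onth_nth _ _ _ _ ke).
lia.
Qed.

End Dynamics.

(** * Lower bound on the total latency of an arbitrary profile *)

Section LowerBound.
Variables (N : network) (delta : nat) (sigma : profile N delta).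
Local Notation x := (exit_time sigma).

(** By [exit_timeE] at [k.+1], the time from departure to this exit is a partial sum of the
    latency. *)
Lemma exit_le_latency p k : k < size (edges (sigma p)) ->
  x p k <= departure p + latency sigma p.
Proof.
move=> kp; have /= := exit_timeE (@exit_timeP _ _ sigma) kp => ->.
rewrite leq_add2l /latency /waiting /route_cost -(big_map transit predT id).
rewrite (big_nth 0) size_map big_mkord -big_split /=.
rewrite -(subnKC kp) big_split_ord /=; exact: leq_addr.
Qed.

Variables (P : nat) (y : edge N -> nat).
Hypothesis priceP : forall r : route N, P <= route_cost r + \sum_(e <- edges r) y e.

(* Either the whole trip takes place before stage [p.1 + 1 + P], or its latency
   exceeds [P]. *)
Lemma latency_ge p : P <= latency sigma p +
  \sum_(k < size (edges (sigma p)))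
    (x p k <= departure p + P) * nth 0 (map y (edges (sigma p))) k.
Proof.
have [lP|/ltnW lP] := leqP (latency sigma p) P; last exact: leq_trans (leq_addr _ _).
apply: leq_trans (priceP (sigma p)) _; rewrite /latency -addnA leq_add2l.
apply: leq_trans (leq_addl _ _).
rewrite -(big_map y predT id) (big_nth 0) size_map big_mkord.
apply: leq_sum => k _; suff -> : x p k <= departure p + P by rewrite mul1n.
by apply: leq_trans (exit_le_latency _) _; rewrite ?leq_add2l.
Qed.

(** Sums [latency_ge] over the players. The first [T] generations depart by stage [T], so the exits
    charged there occur by stage [T + P], and [early_exits_le] bounds their number on each edge. *)
Lemma total_latency_ge T :
  P * delta * T <= \sum_(t < T) generation_latency sigma t
                   + (\sum_e y e * cap e) * (T + P.+1).
Proof.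
pose Y (v : player delta * nat) := nth 0 (map y (edges (sigma v.1))) v.2.
have -> : P * delta * T = \sum_(t < T) \sum_(i < delta) P.
  by rewrite !sum_nat_const !card_ord; lia.
apply: leq_trans (_ : \sum_(t < T) generation_latency sigma t
    + \sum_(v <- visits sigma T) (x v.1 v.2 <= T + P) * Y v <= _); last first.
  rewrite leq_add2l.
  (* The prices are regrouped by edge: each visit has exactly one edge and pays its price. *)
  have -> : \sum_(v <- visits sigma T) (x v.1 v.2 <= T + P) * Y v
    = \sum_e y e * count (fun v => visits_edge sigma e v && (x v.1 v.2 <= T + P))
                         (visits sigma T).
    under [RHS]eq_bigr do rewrite -sum1_count big_mkcond big_distrr /=.
    rewrite exchange_big /= big_seq [RHS]big_seq; apply: eq_bigr => v.
    rewrite mem_visits -onthTE => /andP[_]; case ke: onth => [e|] // _.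
    rewrite (bigD1 e) //= big1 ?addn0 => [|e' ne].
      rewrite /visits_edge ke eqxx /Y (nth_map e) -?onthTE ?ke // (onth_nth _ _ _ _ ke).
      by case: leqP; rewrite ?mul1n ?mul0n ?muln1 ?muln0.
    suff -> : visits_edge sigma e' v = false by rewrite muln0.
    by apply/negbTE; apply: contra ne; rewrite /visits_edge ke => /eqP[->].
  rewrite big_distrl /=; apply: leq_sum => e _; rewrite -mulnA leq_mul2l.
  by rewrite addnS early_exits_le ?orbT //; apply: exit_timeP.
rewrite sum_visits -big_split /=; apply: leq_sum => t _.
rewrite -big_split /=; apply: leq_sum => i _.
apply: leq_trans (latency_ge (nat_of_ord t, i)) _; apply: leq_add => //; apply: leq_sum => k _.
rewrite leq_mul2r; apply/orP; right.
have [h|//] := leqP (x (nat_of_ord t, i) k) (departure (nat_of_ord t, i) + P).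
by rewrite (leq_trans h) // leq_add2r; apply: ltn_ord.
Qed.

End LowerBound.

(** * The steady profile, in which nobody waits *)

Lemma count_onth (T : eqType) (e : T) (l : seq T) :
  count (fun j => onth l j == Some e) (iota 0 (size l)) = count_mem e l.
Proof.
rewrite -(count_map (onth l) (pred1 (Some e))).
have -> : map (onth l) (iota 0 (size l)) = map Some l.
  rewrite (eq_map (onthE l)) -[X in iota 0 X](size_map Some).
  by rewrite -/(mkseq _ _) mkseq_nth.
by rewrite count_map; apply: eq_count => a.
Qed.

Section Steady.
Variables (N : network) (delta : nat) (s : delta.-tuple (route N)).

Definition steady : profile N delta := fun p => tnth s p.2.

Definition free_flow_exit (p : player delta) (k : nat) : nat :=
  departure p
    + \sum_(j < k.+1) nth 0 (map transit (edges (tnth s p.2))) j.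

Hypothesis load_le_cap : forall e,
  \sum_(i < delta) count_mem e (edges (tnth s i)) <= cap e.

Lemma free_flow_entry p k :
  entry free_flow_exit p k = departure p
    + \sum_(j < k) nth 0 (map transit (edges (tnth s p.2))) j.
Proof. by case: k => [|k] //=; rewrite big_ord0 addn0. Qed.

Lemma free_flow_exitE p k e : onth (edges (steady p)) k = Some e ->
  free_flow_exit p k = entry free_flow_exit p k + transit e.
Proof.
move=> ke; rewrite free_flow_entry /free_flow_exit big_ord_recr /= addnA.
congr (_ + _); rewrite (nth_map e) ?(onth_nth _ _ _ _ ke) //.
by rewrite -onthTE -/(steady p) ke.
Qed.

(** In the free-flow schedule a visit is in a queue only at its exit stage. Counting [(p, k)]
    together with the visits ahead of it gives at most the load of [e], hence the strict
    inequality. *)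
Lemma steady_outcome : is_outcome steady free_flow_exit.
Proof.
move=> p k e ke; have xE := free_flow_exitE ke; split; first by rewrite xE.
  2: by move=> u; rewrite xE; lia.
rewrite queue_aheadE -size_filter; set w := seq.filter _ _.
(* the visits in the queue belong to pairwise distinct (player number, edge
   number) pairs, because these determine the generation *)
have vP v : v \in (p, k) :: w -> onth (edges (tnth s v.1.2)) v.2 = Some e /\
    free_flow_exit v.1 v.2 = free_flow_exit p k.
  rewrite inE => /orP[/eqP -> //|]; rewrite mem_filter => /andP[/andP[+ _] _].
  rewrite /in_queue => /andP[/eqP ve]; rewrite -(free_flow_exitE ve) -eqn_leq.
  by move=> /eqP.
pose Q := [seq (i, j) | i <- enum 'I_delta,
  j <- [seq j <- iota 0 (size (edges (tnth s i))) | onth (edges (tnth s i)) j == Some e]].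
have <- : size [seq (v.1.2, v.2) | v <- (p, k) :: w] = (size w).+1 by rewrite size_map.
apply: leq_trans (load_le_cap e).
have <- : size Q = \sum_(i < delta) count_mem e (edges (tnth s i)).
  rewrite size_allpairs_dep sumnE big_map big_enum /=; apply: eq_bigr => i _.
  by rewrite size_filter count_onth.
apply: uniq_leq_size.
  rewrite map_inj_in_uniq; last first.
    move=> [[t i] j] [[t' i'] j'] /vP[_ xv] /vP[_ xv'] [ii jj]; subst i' j'.
    by move: xv'; rewrite -xv /free_flow_exit /departure /= => /addIn[->].
  rewrite /= filter_uniq ?visits_uniq // andbT.
  by rewrite mem_filter before_irr andbF.
move=> _ /mapP[v /vP[ve _] ->]; apply/allpairsPdep; exists v.1.2, v.2.
by rewrite mem_enum mem_filter ve eqxx mem_iota /= add0n -onthTE ve.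
Qed.

(** [exit_time] is a chosen outcome; [outcome_unique] identifies it with the free-flow schedule
    along each route. *)
Lemma steady_latency p : latency steady p = route_cost (steady p).
Proof.
rewrite /latency /waiting big1 ?addn0 // => k _.
have xE j : j < size (edges (steady p)) -> exit_time steady p j = free_flow_exit p j.
  exact: outcome_unique (@exit_timeP _ _ steady) steady_outcome _ _.
have eE : entry (exit_time steady) p k = entry free_flow_exit p k.
  by case: k => -[|k] kp //=; rewrite xE // ltnW.
move: (ltn_ord k); rewrite -onthTE; case ke: onth => [e|] // _.
rewrite xE // eE (free_flow_exitE ke) (nth_map e) //.
by rewrite (onth_nth _ _ _ _ ke) subnn.
Qed.

End Steady.

(** The tuple lists each route [r] exactly [F r] times. Suitable choices of [h] give edge loads,
    costs and route counts. *)
Lemma route_flow_tuple (N : network) (delta : nat) (F : route_flow N) :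
    route_flow_value F = delta ->
  exists s : delta.-tuple (route N), forall h : route N -> nat,
    \sum_(i < delta) h (tnth s i) = \sum_(r <- finsupp F) F r * h r.
Proof.
move=> Fval; pose l := flatten [seq nseq (F r) r | r <- finsupp F].
have lE (h : route N -> nat) :
    \sum_(r <- l) h r = \sum_(r <- finsupp F) F r * h r.
  rewrite big_flatten big_map; apply: eq_bigr => r _.
  by rewrite big_nseq iter_addn_0 mulnC.
have sz : size l == delta.
  by rewrite -sum1_size lE -Fval; apply/eqP; apply: eq_bigr => r _; rewrite muln1.
by exists (Tuple sz) => h; rewrite -lE -(big_tuple _ _ (Tuple sz) predT).
Qed.

(** * Limits of averages *)

Section Limits.
Variable R : realType.
Local Open Scope classical_set_scope.

Lemma limn_einf_ge (u v : (\bar R)^nat) (l : \bar R) :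
  v @ \oo --> l -> (\forall n \near \oo, (v n <= u n)%E) -> (l <= limn_einf u)%E.
Proof.
move=> /cvg_limn_einf_sup[<- _] [n0 _ vu]; rewrite !limn_einf_lim.
apply: lee_lim; [exact: is_cvg_einfs|exact: is_cvg_einfs|].
exists n0 => // n /= n0n; apply/ereal_infP => _ [m /= nm <-].
by apply: le_trans (vu m _); [apply: ereal_inf_lbound; exists m|apply: leq_trans nm].
Qed.

Lemma cvg_sub_div (a b : R) : (a - b / T%:R)%R @[T --> \oo] --> a.
Proof.
(* [harmonic n] is the inverse of [n.+1], hence the shift by one. *)
rewrite -(cvg_shiftS (fun T => a - b / T%:R)%R).
suff : (a - b * harmonic n)%R @[n --> \oo] --> (a - b * 0)%R by rewrite mulr0 subr0.
by apply: cvgB; [exact: cvg_cst|apply: cvgMr; exact: cvg_harmonic].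
Qed.

End Limits.

Theorem theorem3p2 (R : realType) (N : network) (delta : nat)
    (hdelta : (delta <= network_cap N)%N)
    (f : edge N -> nat) (hf : min_cost_flow delta f)
    (F : route_flow N) (hF : route_flow_value F = delta)
    (hFf : corresponds F f) :
  exists sigma : profile N delta,
    socially_optimal R sigma /\
    forall (t : nat) (r : route N), route_count sigma t r = F r.
Proof.
have [s sE] := route_flow_tuple hF.
have load e : \sum_(i < delta) count_mem e (edges (tnth s i)) <= cap e.
  have [[fcap _] _ _] := hf.
  by rewrite (sE (fun r => count_mem e (edges r))) -/(induced_flow F e) hFf.
have [P [y [priceP costP]]] := dual_prices hf hF hFf.
have genE t : generation_latency (steady s) t = flow_cost f.
  rewrite /generation_latency.
  under eq_bigr do rewrite steady_latency //.
  rewrite (sE (@route_cost N)); apply/eqP; rewrite -eqz_nat /flow_cost !Posz_sum.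
  under eq_bigr do rewrite PoszM Posz_sum.
  by rewrite sum_route_flow; apply/eqP/eq_bigr => e _; rewrite hFf PoszM.
exists (steady s); split=> [sigma|t r]; last first.
  rewrite /route_count -sum1_card big_mkcond /=.
  under eq_bigr do rewrite inE.
  (* Here [h] is the indicator of [r]. *)
  rewrite (sE (fun r' => if r' == r then 1 else 0)).
  have [rF|/fsfun_dflt rF] := boolP (r \in finsupp F).
    rewrite (bigD1_seq r) //= eqxx muln1 big1 ?addn0 // => r' /negbTE ->.
    by rewrite muln0.
  by rewrite big1 ?rF // => r' _; case: eqP => [->|_]; rewrite ?rF ?muln0.
(* [K] is the part of the loss in [total_latency_ge] independent of [T]. By [costP] the part linear
   in [T] cancels against [P * delta * T], up to [T * flow_cost f]. *)
pose K := (\sum_e y e * cap e) * P.+1.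
have -> : limn_esup (fun T => (average_latency R (steady s) T)%:E) = ((flow_cost f)%:R)%:E.
  apply: (cvg_limn_einf_sup _).2; apply: cvg_near_cst.
  (* The average is constant from [T = 1] on; at [T = 0] the quotient is 0 by convention. *)
  exists 1 => // T /= T1; rewrite /average_latency; under eq_bigr do rewrite genE.
  rewrite sum_nat_const card_ord natrM mulrC mulKf //.
  by rewrite pnatr_eq0 -lt0n.
apply: (limn_einf_ge (v := fun T => ((flow_cost f)%:R - K%:R / T%:R)%:E)).
  by apply: cvg_EFin; [exact: nearW|exact: cvg_sub_div].
exists 1 => // T /= T1; rewrite lee_fin /average_latency.
have T0 : (0 < T%:R :> R)%R by rewrite ltr0n.
rewrite ler_pdivlMr // mulrBl divfK ?gt_eqF // lerBlDr -natrM -natrD ler_nat.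
have := total_latency_ge sigma priceP T; rewrite -costP /K.
by nia.
Qed.
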